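(* Fix a collection of antichains $\mathbf{A}=\{A_1,A_2,\ldots,A_k\}$ in a finite poset $P$. Suppose these antichains have the property that each element of $A_i$ is incomparable with every element of $A_j$ provided $|i-j|>1$. Then for any $\pi,\omega\in\mathfrak{S}_k$, there is an equivariant bijection between $\mathcal{A}(P)$ under $t_{\mathbf{A}(\pi)}$ and $\mathcal{A}(P)$ under $t_{\mathbf{A}(\omega)}$; that is, a bijection $\varphi:\mathcal{A}(P)\to\mathcal{A}(P)$ with $\varphi\circ t_{\mathbf{A}(\pi)}=t_{\mathbf{A}(\omega)}\circ\varphi$.
   Context: An antichain in a poset $P$ is a set of mutually incomparable elements; $\mathcal{A}(P)\subseteq 2^P$ is the set of antichains of $P$ (including $\emptyset$). For $p\in P$ the toggle $t_p:\mathcal{A}(P)\to\mathcal{A}(P)$ is given by $t_p(X)=X\cup\{p\}$ if $p\notin X$ and $X\cup\{p\}\in\mathcal{A}(P)$; $t_p(X)=X\setminus\{p\}$ if $p\in X$ and $X\setminus\{p\}\in\mathcal{A}(P)$; and $t_p(X)=X$ otherwise. For an antichain $A$ of $P$, $t_A$ denotes the composition of all toggles $t_p$ for $p\in A$ (these commute, so the order does not matter). For $\mathbf{A}=\{A_1,\ldots,A_k\}$ and $\pi\in\mathfrak{S}_k$, $t_{\mathbf{A}(\pi)}:=t_{A_{\pi(1)}}t_{A_{\pi(2)}}\cdots t_{A_{\pi(k)}}$. *)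

(* Defs.v *)
From HB Require Import structures.
From mathcomp Require Import all_boot all_order all_fingroup all_algebra.

Set Implicit Arguments.
Unset Strict Implicit.
Unset Printing Implicit Defensive.

Import Order.TTheory.
Local Open Scope order_scope.

Definition is_antichain d (P : finPOrderType d) (X : {set P}) : bool :=
  [forall p in X, forall q in X, (p != q) ==> (p >< q)].

Record antichain d (P : finPOrderType d) := Antichain {
  antichain_set :> {set P};
  _ : is_antichain antichain_set }.

HB.instance Definition _ d (P : finPOrderType d) :=
  [isSub for @antichain_set d P].
HB.instance Definition _ d (P : finPOrderType d) :=
  [Finite of antichain P by <:].

(* [insubd X Y] is [Y] when [Y] is an antichain, and [X] otherwise. *)
Definition toggle d (P : finPOrderType d) (p : P) (X : antichain P) :
    antichain P :=
  if p \notin (X : {set P}) then insubd X (p |: X) else insubd X (X :\ p).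

(* The order of the factors is irrelevant, see [toggle_set_perm] below. *)
Definition toggle_set d (P : finPOrderType d) (A : antichain P) :
    antichain P -> antichain P :=
  \big[comp/id]_(p <- enum (A : {set P})) toggle p.

(* Composition of functions: the toggle of [A (pi (k - 1))] acts first. *)
Definition toggle_seq d (P : finPOrderType d) (k : nat)
    (A : 'I_k -> antichain P) (pi : 'S_k) : antichain P -> antichain P :=
  \big[comp/id]_(i < k) toggle_set (A (pi i)).

Lemma is_antichainP d (P : finPOrderType d) (X : {set P}) :
  reflect {in X &, forall p q, p != q -> p >< q} (is_antichain X).
Proof.
apply: (iffP 'forall_in_forall_inP) => H p.
  by move=> q pX qX; apply/implyP/H.
by move=> pX q qX; apply/implyP/H.
Qed.

Lemma is_antichainD1 d (P : finPOrderType d) (X : antichain P) (p : P) :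
  is_antichain (X :\ p).
Proof.
case: X => X /= /is_antichainP H; apply/is_antichainP => a b.
by rewrite !inE => /andP[_ aX] /andP[_ bX]; apply: H.
Qed.

Lemma val_toggle d (P : finPOrderType d) (p : P) (X : antichain P) :
  toggle p X =
    (if p \in (X : {set P}) then X :\ p
     else if is_antichain (p |: X) then p |: X else X) :> {set P}.
Proof.
rewrite /toggle; case: ifP => pX.
  by rewrite (negbTE pX) val_insubd.
by rewrite (negbFE pX) val_insubd is_antichainD1.
Qed.

Lemma is_antichainU1 d (P : finPOrderType d) (X : antichain P) (p : P) :
  p \notin (X : {set P}) ->
  is_antichain (p |: X) = [forall q in (X : {set P}), p >< q].
Proof.
move=> pX; apply/is_antichainP/forall_inP => [H q qX | H a b].
  by apply: H; rewrite ?inE ?eqxx ?qX ?orbT //; apply: contraNneq pX => ->.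
rewrite !inE => /predU1P[-> | aX] /predU1P[-> | bX]; rewrite ?eqxx //.
- by move=> _; apply: H.
- by move=> _; rewrite comparable_sym; apply: H.
- by case: X aX bX {pX H} => X /= /is_antichainP H; apply: H.
Qed.

Lemma toggleC d (P : finPOrderType d) (p q : P) :
  p >< q -> toggle p \o toggle q =1 toggle q \o toggle p.
Proof.
have key (a b : P) (X : antichain P) : a >< b ->
    is_antichain (a |: toggle b X) && (a \notin (toggle b X : {set P}))
      = is_antichain (a |: X) && (a \notin (X : {set P})).
  move=> ab; have nab : a != b.
    by apply: contraNneq ab => ->; apply: comparablexx.
  have mem : (a \in (toggle b X : {set P})) = (a \in (X : {set P})).
    rewrite val_toggle; case: ifP => _; first by rewrite !inE nab.
    by case: ifP => _; rewrite ?inE ?(negbTE nab).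
  rewrite mem; case aX: (a \in _); rewrite ?andbF ?andbT //=.
  rewrite !is_antichainU1 ?mem ?aX // val_toggle.
  apply/forall_inP/forall_inP => H c.
    case: (eqVneq c b) => [-> //|cb] cX; apply: H.
    by do 2?case: ifP => _; rewrite ?inE ?cb ?cX ?orbT.
  case: (eqVneq c b) => [-> //|cb] cX; apply: H.
  by move: cX; do 2?case: ifP => _; rewrite ?inE ?(negbTE cb).
have memE (b c : P) (X : antichain P) :
    (c \in (toggle b X : {set P})) =
    if c == b then is_antichain (b |: X) && (b \notin (X : {set P}))
    else c \in (X : {set P}).
  rewrite val_toggle; case: eqVneq => [->|cb].
    case: ifP => bX; first by rewrite !inE eqxx andbF.
    by case: ifP => _; rewrite ?inE ?eqxx ?bX.
  by do 2?case: ifP => _; rewrite ?inE ?cb ?(negbTE cb).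
move=> pq X; have qp : q >< p by rewrite comparable_sym.
have npq : p != q by apply: contraNneq pq => ->; apply: comparablexx.
apply/val_inj/setP => c; rewrite /= !(memE _ c) (key p q X pq) (key q p X qp).
by case: (eqVneq c p) => [->|//]; rewrite (negbTE npq).
Qed.

Lemma toggle_set_perm d (P : finPOrderType d) (A : antichain P) (s : seq P) :
  perm_eq s (enum (A : {set P})) ->
  toggle_set A =1 \big[comp/id]_(p <- s) toggle p.
Proof.
have foldE (r : seq P) X :
    (\big[comp/id]_(p <- r) toggle p) X = foldr (@toggle d P) X r.
  by elim: r => [|a r IH]; rewrite ?big_nil // big_cons /= IH.
have comm a b X : a \in (A : {set P}) -> b \in (A : {set P}) ->
    toggle a (toggle b X) = toggle b (toggle a X).
  case: (eqVneq a b) => [-> //|nab aA bA]; apply: toggleC.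
  by case: A aA bA => A' /= /is_antichainP H aA bA; apply: H.
move=> sA X; rewrite /toggle_set !foldE.
have sub : {subset enum (A : {set P}) <= (A : {set P})}.
  by move=> a; rewrite mem_enum.
move: sub sA; move: (enum _) => r; elim: r s => [|a r IH] s sub.
  by move/perm_nilP ->.
move=> sr; have as_ : a \in s by rewrite (perm_mem sr) mem_head.
have subs : {subset s <= (A : {set P})}.
  by move=> b; rewrite (perm_mem sr); apply: sub.
case/splitPr: as_ sr subs => s1 s2 sr subs.
have sr' : perm_eq (s1 ++ s2) r.
  by rewrite -(perm_cons a) -(perm_catCA [:: a] s1 s2) /= in sr *.
rewrite /= (IH (s1 ++ s2)) //; last by move=> b br; apply: sub; rewrite inE br orbT.
rewrite !foldr_cat /=; move: (foldr _ _ s2) => Y.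
have aA : a \in (A : {set P}) by apply: subs; rewrite mem_cat mem_head orbT.
have subs1 : {subset s1 <= (A : {set P})}.
  by move=> b bs; apply: subs; rewrite mem_cat bs.
elim: s1 subs1 {sr sr' subs} => [//|b s1 IH1] subs1 /=.
have bA : b \in (A : {set P}) by apply/subs1/mem_head.
rewrite comm // IH1 // => c cs.
by apply: subs1; rewrite inE cs orbT.
Qed.

(* Main.v *)
Require Import Defs.
From mathcomp Require Import all_boot all_order all_fingroup all_algebra.

(** In a group, if [g_i] and [g_j] commute whenever [|i - j| > 1], then the
    products of [g_0, ..., g_(n+1)] taken in any order are all conjugate: the
    last generator [g_(n+1)] commutes with every factor other than [g_n], so it
    can be moved next to [g_n] and merged with it, which leaves a shorter family
    with the same commutation property.  By induction the product is conjugate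
    to [g_0 ... g_n g_(n+1)] or to [g_0 ... g_(n-1) g_(n+1) g_n]; in the latter
    [g_(n+1)] can be moved to the front and then cycled to the end.  This is
    applied to the permutations of the set of antichains induced by the
    antichain toggles. *)

Section PathProducts.

Local Open Scope group_scope.

Lemma prod_conj_iota {gT : finGroupType} (n : nat) (g : nat -> gT) (s : seq nat) :
  (forall i j, (i.+1 < j < n)%N -> commute (g i) (g j)) ->
  perm_eq s (iota 0 n) ->
  exists x, (\prod_(i <- s) g i) ^ x = \prod_(i <- iota 0 n) g i.
Proof.
elim: n g s => [|[|n] IHn] g s gC.
- by move=> /perm_nilP->; exists 1; rewrite conjg1.
- by move=> /perm_small_eq-> //; exists 1; rewrite conjg1.
move=> sP.
have split_iota : iota 0 n.+2 = rcons (iota 0 n.+1) n.+1.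
  by rewrite -cats1 -[n.+2]addn1 iotaD.
have split_iota' : iota 0 n.+1 = rcons (iota 0 n) n.
  by rewrite -cats1 -[n.+1]addn1 iotaD.
have sn : n.+1 \in s by rewrite (perm_mem sP) mem_iota ltnSn.
case/splitPr: sn sP => s1 s2 sP.
have s'P : perm_eq (s1 ++ s2) (iota 0 n.+1).
  rewrite -(perm_cons n.+1) -(perm_catCA s1 [:: n.+1] s2) /=.
  by rewrite (perm_trans sP) // split_iota perm_rcons.
have bnd i : i \in s1 ++ s2 -> (i <= n)%N.
  by rewrite (perm_mem s'P) mem_iota.
have uniq_s' : uniq (s1 ++ s2) by rewrite (perm_uniq s'P) iota_uniq.
(* Position [n] is to carry the combined factor [h] and index [n.+1] disappears; the induction
   hypothesis is general in [g], so it applies to [merge h]. *)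
pose merge (h : gT) i := if i == n then h else g i.
have merge_far (h : gT) (u : seq nat) : n \notin u ->
    \prod_(i <- u) merge h i = \prod_(i <- u) g i.
  move=> nu; apply: eq_big_seq => i iu; rewrite /merge.
  by case: eqP => // ni; rewrite -ni iu in nu.
have comm_last (u : seq nat) : {subset u <= s1 ++ s2} -> n \notin u ->
    commute (g n.+1) (\prod_(i <- u) g i).
  move=> us nu; rewrite big_seq.
  apply: (big_ind (commute (g n.+1))) => [|x y|i iu]; first exact: commute1.
    exact: commuteM.
  apply/commute_sym/gC; rewrite ltnS ltnSn andbT ltn_neqAle bnd ?us // andbT.
  by apply: contraNneq nu => <-.
(* Only pairs with [j = n] are new. There [i.+1 < n], which is the range [i < n.-1], empty for
   [n = 0]. *)
have merge_comm (h : gT) :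
    (forall i, (i < n.-1)%N -> commute (g i) h) ->
    forall i j, (i.+1 < j < n.+1)%N -> commute (merge h i) (merge h j).
  move=> hC i j /andP[ij jn]; rewrite /merge.
  have in_ : (i < n)%N by rewrite (leq_trans _ (jn : (j <= n)%N)) // ltnW.
  rewrite (ltn_eqF in_); case: eqP => [jE|_]; last by apply: gC; rewrite ij ltnW.
  by apply: hC; move: ij; rewrite jE; case: (n).
have gn_comm i : (i < n.-1)%N -> commute (g i) (g n) /\ commute (g i) (g n.+1).
  move=> i_n; have ltin : (i.+1 < n)%N by case: (n) i_n.
  by split; apply: gC; rewrite ?ltnSn ?leqnSn ?andbT // ltnW.
have nS : n \in s1 ++ s2 by rewrite (perm_mem s'P) mem_iota ltnSn.
have prod_iota (h : gT) : \prod_(i <- iota 0 n.+1) merge h i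
    = (\prod_(i <- iota 0 n) g i) * h.
  rewrite split_iota' -cats1 big_cat big_seq1 merge_far ?mem_iota ?ltnn //.
  by rewrite /merge eqxx.
have goalE : \prod_(i <- iota 0 n.+2) g i
    = (\prod_(i <- iota 0 n) g i) * (g n * g n.+1).
  by rewrite split_iota split_iota' -!cats1 !big_cat !big_seq1 mulgA.
move: nS; rewrite mem_cat => /orP[ns|ns].
(* Here [n] precedes [n.+1]: the factor [g n.+1] moves left until it stands just after [g n]. *)
- have nC i : (i < n.-1)%N -> commute (g i) (g n * g n.+1).
    by case/gn_comm; apply: commuteM.
  have [x xE] := IHn _ _ (merge_comm _ nC) s'P.
  exists x; rewrite goalE -prod_iota -xE; congr (_ ^ x).
  move: uniq_s' comm_last {bnd sP s'P xE}; case/splitPr: ns => u v.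
  rewrite -catA /= uniq_catC /= !mem_cat !negb_or -!andbA.
  case/and4P=> nv ns2 nu _ comm_last; rewrite !big_cat !big_cons /=.
  rewrite !big_cat /= !merge_far // {1}/merge eqxx -!mulgA.
  congr (_ * (_ * _)); rewrite !mulgA; congr (_ * _).
  rewrite comm_last // => i iv.
  by rewrite !(mem_cat, inE) iv !orbT.
(* Here [n] follows [n.+1]: the factor [g n.+1] moves right until it stands just before [g n]. *)
- have nC i : (i < n.-1)%N -> commute (g i) (g n.+1 * g n).
    by case/gn_comm=> ? ?; apply: commuteM.
  have [x xE] := IHn _ _ (merge_comm _ nC) s'P.
  have iotaC : commute (g n.+1) (\prod_(i <- iota 0 n) g i).
    apply: comm_last; last by rewrite mem_iota ltnn.
    move=> i; rewrite (perm_mem s'P) !mem_iota /= !add0n.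
    exact: ltnW.
  (* After [x], the last two factors are still in the wrong order. Conjugation by [g n.+1] cancels
     this factor, once moved to the front, and restores it at the end. *)
  exists (x * g n.+1); rewrite conjgM.
  transitivity ((\prod_(i <- iota 0 n.+1) merge (g n.+1 * g n) i) ^ g n.+1).
    rewrite -xE; congr ((_ ^ x) ^ _).
    move: uniq_s' comm_last {bnd sP s'P xE iotaC}; case/splitPr: ns => u v.
    rewrite catA uniq_catC /= !mem_cat !negb_or -!andbA.
    case/and4P=> nv ns1 nu _ comm_last.
    rewrite !big_cat !big_cons /= !big_cat /= !big_cons !merge_far //.
    rewrite {1}/merge eqxx -!mulgA; congr (_ * _).
    rewrite !mulgA comm_last // => i iu.
    by rewrite !(mem_cat, inE) iu !orbT.
  by rewrite prod_iota goalE [X in X ^ _]mulgA -iotaC conjgE -!mulgA mulKg.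
Qed.

Lemma prod_perm_conj {gT : finGroupType} (n : nat) (g : nat -> gT) (s t : seq nat) :
  (forall i j, (i.+1 < j < n)%N -> commute (g i) (g j)) ->
  perm_eq s (iota 0 n) -> perm_eq t (iota 0 n) ->
  exists x, (\prod_(i <- s) g i) ^ x = \prod_(i <- t) g i.
Proof.
move=> gC /(prod_conj_iota _ _ _ gC)[x xE] /(prod_conj_iota _ _ _ gC)[y yE].
by exists (x * y^-1); rewrite conjgM xE -yE conjgK.
Qed.

End PathProducts.

Section Toggles.

Context {d : Order.disp_t} {P : finPOrderType d}.
Implicit Types (p q : P) (A B X : antichain P).

Lemma toggleK p : involutive (@toggle d P p).
Proof.
move=> X; apply/val_inj; rewrite /= !val_toggle.
case pX: (p \in (X : {set P})).
  have Xp : p |: (X :\ p) = X by rewrite setD1K.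
  by rewrite !inE eqxx /= Xp; case: X {pX Xp} => X /= ->.
case: (boolP (is_antichain (p |: X))) => aX.
  by rewrite setU11 setU1K ?pX.
by rewrite pX (negbTE aX).
Qed.

Lemma toggle_setE A X : toggle_set A X = foldr (@toggle d P) X (enum (A : {set P})).
Proof.
rewrite /toggle_set; elim: (enum _) => [|p r IHr]; first by rewrite big_nil.
by rewrite big_cons /= IHr.
Qed.

(** Injectivity on the finite type of antichains is what makes the map a permutation, hence an
    element of a finite group. *)
Lemma toggle_set_inj A : injective (@toggle_set d P A).
Proof.
move=> X Y; rewrite !toggle_setE; elim: (enum _) => //= p r IHr.
by move/(can_inj (toggleK p))/IHr.
Qed.

Lemma toggle_setC A B :
  {in (A : {set P}) & (B : {set P}), forall p q, (p >< q)%O} ->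
  toggle_set A \o toggle_set B =1 toggle_set B \o toggle_set A.
Proof.
move=> AB X; rewrite /= !toggle_setE.
have: {in enum (A : {set P}) & enum (B : {set P}), forall p q, (p >< q)%O}.
  by move=> p q; rewrite !mem_enum; apply: AB.
elim: (enum (A : {set P})) => //= p r IHr pB.
(* The rest of [A] is already past [B]; the inner induction carries the single toggle at [p] past
   [B], one element at a time. *)
rewrite {}IHr; last by move=> a b ar; apply: pB; rewrite inE ar orbT.
have {}pB q : q \in enum (B : {set P}) -> (p >< q)%O by apply/pB/mem_head.
elim: (enum (B : {set P})) pB => //= q u IHu pu.
rewrite -IHu => [|a au]; last by apply: pu; rewrite inE au orbT.
exact: toggleC (pu _ (mem_head _ _)) _.
Qed.

Definition toggle_perm A : {perm antichain P} := perm (@toggle_set_inj A).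

(** Indexing by [nat], with the identity as default from [k] on, matches the group lemma, whose
    induction shortens the index range. *)
Definition toggle_gen {k : nat} (A : 'I_k -> antichain P) (i : nat) :
    {perm antichain P} :=
  if insub i is Some j then toggle_perm (A j) else 1%g.

(* Products in [{perm T}] apply their leftmost factor first, hence [rev]. *)
Lemma toggle_seqE {k : nat} (A : 'I_k -> antichain P) (pi : 'S_k) X :
  toggle_seq A pi X =
  (\prod_(i <- rev [seq val (pi j) | j <- enum 'I_k]) toggle_gen A i)%g X.
Proof.
rewrite /toggle_seq -[index_enum _]enumT.
elim: (enum _) X => [|j r IHr] X; first by rewrite !big_nil perm1.
rewrite big_cons /= rev_cons -cats1 big_cat big_seq1 permM -IHr.
by rewrite /toggle_gen valK permE.
Qed.

Lemma perm_eq_iota_perm {k : nat} (pi : 'S_k) :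
  perm_eq (rev [seq val (pi j) | j <- enum 'I_k]) (iota 0 k).
Proof.
rewrite perm_rev -val_enum_ord (map_comp val pi); apply: perm_map.
apply: uniq_perm; rewrite ?(map_inj_uniq perm_inj) ?enum_uniq // => i.
by rewrite -[i](permKV pi) (mem_map perm_inj) !mem_enum.
Qed.

End Toggles.

Theorem theorem3p14 (d : Order.disp_t) (P : finPOrderType d) (k : nat)
    (A : 'I_k -> antichain P)
    (hA : forall i j : 'I_k, (1 < `|i - j|)%N ->
       forall p q : P, p \in (A i : {set P}) -> q \in (A j : {set P}) ->
       (p >< q)%O)
    (pi omega : 'S_k) :
  exists phi : antichain P -> antichain P,
    bijective phi /\
    phi \o toggle_seq A pi =1 toggle_seq A omega \o phi.
Proof.
have genC i j : (i.+1 < j < k)%N -> commute (toggle_gen A i) (toggle_gen A j).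
  case/andP=> ij jk; have ik : (i < k)%N by apply: ltn_trans (ltnW ij) jk.
  rewrite /toggle_gen !insubT; apply/permP => X; rewrite !permM !permE.
  apply: toggle_setC => p q pj qi.
  (* Since [permM] reverses composition, [p] lies in [A j] and [q] in [A i], and the distance to
     bound is [j - i]. *)
  apply: hA pj qi; rewrite /= distnEl; first by rewrite ltn_subRL addn1.
  exact: ltnW (ltnW ij).
have [x xE] := prod_perm_conj _ _ _ _ genC
  (perm_eq_iota_perm pi) (perm_eq_iota_perm omega).
(* The conjugator is itself a permutation of the antichains. With [a] and [b] the two products,
   [a ^ x = b] gives [a * x = x * b], which read as maps is the equivariance. *)
exists x; split; first by exists (x^-1)%g; [apply: permK | apply: permKV].
by move=> X; rewrite /= !toggle_seqE -xE -!permM conjgE !mulgA mulgV mul1g.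
Qed.
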